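(* Let $U:\mathbb{R}^3\to\mathbb{R}$ be the quadratic scalar potential $U(x)=\frac12 x^{\intercal}Qx+q^{\intercal}x$ with a symmetric matrix $Q\in\mathbb{R}^{3\times 3}$ and a vector $q\in\mathbb{R}^3$, and let $F=-\nabla U$. Let $B=\nabla\times A:\mathbb{R}^3\to\mathbb{R}^3$ be a magnetic field and let $\epsilon=1$ (normal magnetic field) or $0<\epsilon\ll 1$ (strong magnetic field). Let $(x_n,v_n)_{n\ge 0}$ in $\mathbb{R}^3\times\mathbb{R}^3$ be a numerical solution with stepsize $h$ of the method $$x_{n+1}=x_n+h\,v_{n+1/2},\qquad v_{n+1}=v_n+h\,v_{n+1/2}\times\tfrac1\epsilon B(x_{n+1/2})+h\,F(x_{n+1/2}),$$ where $v_{n+1/2}=\frac{v_n+v_{n+1}}2$ and $x_{n+1/2}=\frac{x_n+x_{n+1}}2$. Then the energy $E(x,v)=\frac12|v|^2+U(x)$ is preserved exactly: $$E(x_{n+1},v_{n+1})=E(x_n,v_n)\qquad\text{for } n=0,1,\ldots.$$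
   Context: The method (called TSM1) is applied to the charged-particle dynamics $\ddot x=\dot x\times\frac1\epsilon B(x)+F(x)$ in $\mathbb{R}^3$, with velocity $v=\dot x$, where $B=\nabla\times A$ is a magnetic field with vector potential $A:\mathbb{R}^3\to\mathbb{R}^3$ and $F=-\nabla U$ is an electric field with scalar potential $U$. Here $\times$ is the cross product on $\mathbb{R}^3$ and $|\cdot|$ the Euclidean norm. *)

(* Defs.v *)
From mathcomp Require Import all_boot all_order all_algebra.
From mathcomp Require Import all_classical all_reals all_analysis.

Set Implicit Arguments.
Unset Strict Implicit.
Unset Printing Implicit Defensive.

Import Order.TTheory GRing.Theory Num.Theory.
Import numFieldNormedType.Exports.

Local Open Scope ring_scope.

(* Vectors of R^3 are column vectors with indices 0, 1, 2 : 'I_3. *)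
Definition vec3 (R : realType) (a b c : R) : 'cV[R]_3 :=
  \col_i [:: a; b; c]`_i.

Definition crossmul (R : realType) (u v : 'cV[R]_3) : 'cV[R]_3 :=
  vec3 (u 1 0 * v 2 0 - u 2 0 * v 1 0)
       (u 2 0 * v 0 0 - u 0 0 * v 2 0)
       (u 0 0 * v 1 0 - u 1 0 * v 0 0).

(* The library norm `|v| of a matrix is the sup norm, hence this definition. *)
Definition enorm (R : realType) (v : 'cV[R]_3) : R :=
  Num.sqrt (\sum_i v i 0 ^+ 2).

Definition partial (R : realType) (i : 'I_3) (f : 'cV[R]_3 -> R)
    (x : 'cV[R]_3) : R :=
  'D_(delta_mx i 0) f x.

Definition gradient (R : realType) (f : 'cV[R]_3 -> R) (x : 'cV[R]_3) :
    'cV[R]_3 :=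
  \col_i partial i f x.

Definition curl (R : realType) (A : 'cV[R]_3 -> 'cV[R]_3) (x : 'cV[R]_3) :
    'cV[R]_3 :=
  let d i j := partial i (fun y => A y j 0) x in
  vec3 (d 1 2 - d 2 1) (d 2 0 - d 0 2) (d 0 1 - d 1 0).

Definition midpoint (R : realType) (u w : 'cV[R]_3) : 'cV[R]_3 :=
  2^-1 *: (u + w).

(* One step (x, v) |-> (x', v') of the implicit method TSM1, as a relation:
   neither solvability nor uniqueness of the step is presupposed. *)
Definition TSM1_step (R : realType) (eps h : R) (B F : 'cV[R]_3 -> 'cV[R]_3)
    (x v x' v' : 'cV[R]_3) : Prop :=
  x' = x + h *: midpoint v v' /\
  v' = v + h *: crossmul (midpoint v v') (eps^-1 *: B (midpoint x x'))
         + h *: F (midpoint x x').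

Definition energy (R : realType) (U : 'cV[R]_3 -> R) (x v : 'cV[R]_3) : R :=
  2^-1 * enorm v ^+ 2 + U x.

(* Main.v *)
Require Import Defs.
From mathcomp Require Import all_boot all_order all_algebra.
From mathcomp Require Import all_classical all_reals all_analysis.
From mathcomp Require Import ring.

Import Order.TTheory GRing.Theory Num.Theory.
Import numFieldNormedType.Exports.

Local Open Scope classical_set_scope.
Local Open Scope ring_scope.

(** The increment of the kinetic energy over one step is the inner product of
    [v' - v] with the mean velocity [(v + v') / 2], because [|v|^2] is a
    quadratic form.  For the same reason the increment of [U] is exactly the
    inner product of [x' - x] with the gradient of [U] at the midpoint of [x]
    and [x']: the chord slope of a quadratic function is its derivative at the
    middle of the chord ([quadratic_symmetric_difference]), and that derivative
    is [Q y + q] ([gradient_quadratic]).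

    Substituting the two update formulas, [v' - v] contributes a magnetic
    term, orthogonal to the mean velocity since it is a cross product with it
    ([dot_crossmul]), and the work [h F . (v + v') / 2] of the force at the
    midpoint.  As [x' - x] is [h] times the mean velocity and [F] is minus the
    gradient, the potential energy changes by the opposite amount. *)

Section InnerProduct.
Set Implicit Arguments.
Unset Strict Implicit.
Variable R : realType.
Implicit Types (u v w : 'cV[R]_3) (c : R).

Definition dot u v : R := (u^T *m v) 0 0.

Lemma dotE u v : dot u v = \sum_i u i 0 * v i 0.
Proof. by rewrite /dot mxE; apply: eq_bigr => i _; rewrite mxE. Qed.

Lemma dotC u v : dot u v = dot v u.
Proof. by rewrite !dotE; apply: eq_bigr => i _; rewrite mulrC. Qed.

Lemma dotDr u v w : dot u (v + w) = dot u v + dot u w.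
Proof. by rewrite /dot mulmxDr mxE. Qed.

Lemma dotZr c u v : dot u (c *: v) = c * dot u v.
Proof. by rewrite /dot -scalemxAr mxE. Qed.

Lemma dotNr u v : dot u (- v) = - dot u v.
Proof. by rewrite -scaleN1r dotZr mulN1r. Qed.

Lemma dotDl u v w : dot (u + v) w = dot u w + dot v w.
Proof. by rewrite dotC dotDr !(dotC w). Qed.

Lemma dotZl c u v : dot (c *: u) v = c * dot u v.
Proof. by rewrite dotC dotZr dotC. Qed.

Lemma dotNl u v : dot (- u) v = - dot u v.
Proof. by rewrite dotC dotNr dotC. Qed.

Lemma dot_delta u (i : 'I_3) : dot u (delta_mx i 0) = u i 0.
Proof.
rewrite dotE (bigD1 i) //= mxE !eqxx mulr1 big1 ?addr0 // => j ji.
by rewrite mxE (negbTE ji) mulr0.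
Qed.

Lemma sqr_enorm v : enorm v ^+ 2 = dot v v.
Proof.
rewrite /enorm sqr_sqrtr; last by apply: sumr_ge0 => i _; exact: sqr_ge0.
by rewrite dotE; apply: eq_bigr => i _; rewrite expr2.
Qed.

Lemma dot_crossmul u v : dot (crossmul u v) u = 0.
Proof.
rewrite dotE !big_ord_recl big_ord0 !mxE /=.
have -> : lift ord0 (ord0 : 'I_2) = 1 :> 'I_3 by apply/val_inj.
have -> : lift ord0 (lift ord0 (ord0 : 'I_1)) = 2 :> 'I_3 by apply/val_inj.
by ring.
Qed.

Lemma dot_mulmx_sym (Q : 'M[R]_3) u v : Q^T = Q ->
  dot u (Q *m v) = dot (Q *m u) v.
Proof. by move=> Q_sym; rewrite /dot trmx_mul Q_sym mulmxA. Qed.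

Lemma dot_midpoint_sub u v :
  dot (v - u) (midpoint u v) = 2^-1 * (dot v v - dot u u).
Proof.
by rewrite dotZr dotDr !dotDl !dotNl (dotC v u); congr (_ * _); ring.
Qed.

End InnerProduct.

(** For [t != 0] the difference quotient is the affine function [a + t * c],
    which tends to [a]. *)
Lemma derive_quadratic_expansion (R : realType) (f : 'cV[R]_3 -> R)
    (y d : 'cV[R]_3) (a c : R) :
  (forall t, f (y + t *: d) = f y + t * a + t ^+ 2 * c) -> 'D_d f y = a.
Proof.
move=> fE; rewrite /derive; apply/cvg_lim => //.
have a_cvg : (fun t : R => a + t * c) t @[t --> 0^'] --> a.
  rewrite -[X in _ --> X]addr0 -[X in _ + X](mul0r c).
  apply: cvgD; first exact: cvg_cst.
  by apply: cvgM; [exact: cvg_within | exact: cvg_cst].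
apply: cvg_trans a_cvg; apply: near_eq_cvg.
near=> t.
have t0 : t != 0 by near: t; exact: nbhs_dnbhs_neq.
rewrite /= [t *: d + y]addrC fE /GRing.scale /=.
by field.
Unshelve. all: by end_near.
Qed.

Section QuadraticPotential.
Set Implicit Arguments.
Unset Strict Implicit.
Variables (R : realType) (Q : 'M[R]_3) (q : 'cV[R]_3) (U : 'cV[R]_3 -> R).
Hypothesis Q_sym : Q^T = Q.
Hypothesis U_def :
  forall y, U y = 2^-1 * (y^T *m Q *m y) 0 0 + (q^T *m y) 0 0.

(** The exact Taylor expansion: symmetry of [Q] is what merges the two mixed
    terms into a single one with vector [Q y + q]. *)
Lemma quadratic_expansion y d :
  U (y + d) = U y + dot (Q *m y + q) d + 2^-1 * dot d (Q *m d).
Proof.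
have UE z : U z = 2^-1 * dot z (Q *m z) + dot q z by rewrite U_def /dot mulmxA.
rewrite !UE mulmxDr !dotDr !dotDl (dot_mulmx_sym y d Q_sym).
rewrite (dotC d (Q *m y)).
by field.
Qed.

Lemma gradient_quadratic y : gradient U y = Q *m y + q.
Proof.
apply/matrixP => i j; rewrite ord1 mxE.
apply: (@derive_quadratic_expansion _ _ _ _ _
  (2^-1 * dot (delta_mx i 0) (Q *m delta_mx i 0))) => t.
rewrite quadratic_expansion dotZr dot_delta -scalemxAr dotZr dotZl.
by ring.
Qed.

(** The expansions at the midpoint with increments [d] and [- d] have the same
    second-order term, so it cancels in the difference. *)
Lemma quadratic_symmetric_difference x x' :
  U x' - U x = dot (gradient U (midpoint x x')) (x' - x).
Proof.
pose m := midpoint x x'; pose d := 2^-1 *: (x' - x).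
have x'E : x' = m + d by apply/matrixP => i j; rewrite !mxE; field.
have xE : x = m - d by apply/matrixP => i j; rewrite !mxE; field.
have dE : x' - x = 2 *: d by rewrite scalerA mulfV ?scale1r // pnatr_eq0.
rewrite dE gradient_quadratic -/m {1}x'E {1}xE; clearbody m d.
rewrite !quadratic_expansion mulmxN !dotNr dotNl dotZr.
by ring.
Qed.

End QuadraticPotential.

Theorem theorem3p1 (R : realType)
  (Q : 'M[R]_3) (q : 'cV[R]_3) (U : 'cV[R]_3 -> R)
  (A B F : 'cV[R]_3 -> 'cV[R]_3) (eps h : R) (x v : nat -> 'cV[R]_3)
  (Q_sym : Q^T = Q)
  (U_def : forall y, U y = 2^-1 * (y^T *m Q *m y) 0 0 + (q^T *m y) 0 0)
  (F_def : forall y, F y = - gradient U y)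
  (A_diff : forall y, differentiable A y)
  (B_def : forall y, B y = curl A y)
  (eps_def : eps = 1 \/ 0 < eps < 1)
  (method : forall n : nat, TSM1_step eps h B F (x n) (v n) (x n.+1) (v n.+1)) :
  forall n : nat, energy U (x n.+1) (v n.+1) = energy U (x n) (v n).
Proof.
move=> n; have [x_step v_step] := method n.
move: (x n) (v n) (x n.+1) (v n.+1) x_step v_step => x0 v0 x1 v1 x_step v_step.
have dx : x1 - x0 = h *: midpoint v0 v1 by rewrite x_step addrC addKr.
have dv : v1 - v0 = h *: crossmul (midpoint v0 v1) (eps^-1 *: B (midpoint x0 x1))
    + h *: F (midpoint x0 x1).
  by apply/eqP; rewrite subr_eq [_ + v0]addrC addrA; exact/eqP.
have kinetic := dot_midpoint_sub v0 v1.
have potential := quadratic_symmetric_difference Q_sym U_def x0 x1.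
rewrite dv dotDl !dotZl dot_crossmul mulr0 add0r F_def dotNl in kinetic.
rewrite dx dotZr in potential.
apply/eqP; rewrite -subr_eq0 /energy !sqr_enorm opprD addrACA -mulrBr.
by rewrite -kinetic potential mulrN addNr.
Qed.
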